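(* There exist an absolute constant $c>0$ and $n_0\in\mathbb N$ such that for all $n\ge n_0$ there is a convex body $C=C_n$ in $\mathbb R^n$ whose centroid $g=g(C)$ and Santaló point $s=s(C)$ satisfy $$c\le \frac{\|g(C)-s(C)\|_2}{\operatorname{vol}_1(\ell\cap C)}=\frac{\|g(C)-s(C)\|_2}{w_C(u)},$$ where $\ell$ is the line through $g$ and $s$ (in particular $g\neq s$), $u=\frac{g-s}{\|g-s\|_2}$, and $w_C(u)=h_C(u)+h_C(-u)$ is the width of $C$ in direction $u$.
   Context: A convex body in $\mathbb R^n$ is a compact convex set with nonempty interior. $\|\cdot\|_2$ is the Euclidean norm, $\operatorname{vol}_k$ is $k$-dimensional volume, and $h_K(u)=\max_{x\in K}\langle u,x\rangle$ is the support function of $K$. The centroid of $K$ is $g(K)=\frac{1}{\operatorname{vol}_n(K)}\int_K x\,dx$. For $x\in K$, $K^x=(K-x)^\circ=\{y\in\mathbb R^n:\langle y,z-x\rangle\le 1 \text{ for all } z\in K\}$ is the polar body of $K$ with respect to $x$. The Santaló point $s(K)$ is the unique point $x$ at which $\operatorname{vol}_n(K)\operatorname{vol}_n(K^x)$ attains its minimum. *)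

(* Defs.v *)
(* R^n is represented by the row vectors 'rV[R]_n, R : realType. *)
From HB Require Import structures.
From mathcomp Require Import all_boot all_order all_algebra.
From mathcomp Require Import all_classical all_reals all_analysis.

Set Implicit Arguments.
Unset Strict Implicit.
Unset Printing Implicit Defensive.

Import Order.TTheory GRing.Theory Num.Theory.
Import numFieldNormedType.Exports.

Local Open Scope classical_set_scope.
Local Open Scope ring_scope.

(* The sigma-algebra on 'rV[R]_n generated by the coordinates (the Borel one),
   set up exactly as the library does for n.-tuple T. *)
Section rV_measurable.
Context (R : realType) (n : nat).

Let coords (i : 'I_n) (v : 'rV[R]_n) : measurableTypeR R := v ord0 i.

Let rV_set0 : g_sigma_preimage coords set0.
Proof. exact: sigma_algebra0. Qed.

Let rV_setC A : g_sigma_preimage coords A -> g_sigma_preimage coords (~` A).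
Proof. exact: sigma_algebraC. Qed.

Let rV_bigcup (F : _^nat) : (forall i, g_sigma_preimage coords (F i)) ->
  g_sigma_preimage coords (\bigcup_i (F i)).
Proof. exact: sigma_algebra_bigcup. Qed.

HB.instance Definition _ := @isMeasurable.Build default_measure_display
  'rV[R]_n (g_sigma_preimage coords) rV_set0 rV_setC rV_bigcup.

End rV_measurable.

Lemma measurable_rV_coord (R : realType) n (i : 'I_n) :
  measurable_fun [set: 'rV[R]_n]
    (fun v : 'rV[R]_n => v ord0 i : measurableTypeR R).
Proof.
move=> _ Y mY; rewrite setTI; apply: sub_sigma_algebra => /=.
rewrite -bigcup_seq/=; exists i => /=; first by rewrite mem_index_enum.
by exists Y => //; rewrite setTI.
Qed.

Lemma measurable_fun_rV (R : realType) n (d : measure_display)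
    (T : measurableType d) (f : T -> 'rV[R]_n) :
  (forall i, measurable_fun setT (fun x => f x ord0 i : measurableTypeR R)) ->
  measurable_fun setT f.
Proof.
move=> mf; apply: (@measurability _ _ _ _ setT f
  (\big[setU/set0]_(i < n) preimage_set_system [set: 'rV[R]_n]
     (fun v : 'rV[R]_n => v ord0 i : measurableTypeR R) measurable)) => //.
move=> _ [A + <-]; rewrite -bigcup_seq/= => -[i _ [B mB <-]].
rewrite [X in _ `&` X](_ : _ = (fun x => f x ord0 i) @^-1` B).
  exact: (mf i measurableT B mB).
by rewrite setTI.
Qed.

Definition rV_cons (R : realType) n (p : measurableTypeR R * 'rV[R]_n) :
  'rV[R]_n.+1 := \row_i if unlift ord0 i is Some j then p.2 ord0 j else p.1.

Lemma measurable_rV_cons (R : realType) n :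
  measurable_fun setT (@rV_cons R n).
Proof.
apply: measurable_fun_rV => i.
case: (unliftP ord0 i) => [j|] ->.
  rewrite [X in measurable_fun _ X](_ : _ =
    (fun v : 'rV[R]_n => v ord0 j : measurableTypeR R) \o snd).
    by apply: measurableT_comp => //; exact: measurable_rV_coord.
  by apply/funext => p /=; rewrite mxE liftK.
rewrite [X in measurable_fun _ X](_ : _ = fst)//.
by apply/funext => p; rewrite mxE unlift_none.
Qed.

Section rV_lebesgue_step.
Context (R : realType) (n : nat).
Variable mu : {sigma_finite_measure set 'rV[R]_n -> \bar R}.

Definition lebesgue_rV_step : set 'rV[R]_n.+1 -> \bar R :=
  pushforward (lebesgue_measure \x mu)%E (@rV_cons R n).

Let step : {measure set 'rV[R]_n.+1 -> \bar R} :=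
  measure_function_pushforward__canonical__measure_function_Measure
    (lebesgue_measure \x mu)%E (@measurable_rV_cons R n).

HB.instance Definition _ := isMeasure.Build _ _ _ lebesgue_rV_step
  (measure0 step) (measure_ge0 step) (@measure_semi_sigma_additive _ _ _ step).

Let step_sigma_finite : sigma_finite setT lebesgue_rV_step.
Proof.
have /sigma_finiteP[F [FT ndF Foo]] := sigma_finiteT (@lebesgue_measure R).
have /sigma_finiteP[G [GT ndG Goo]] := sigma_finiteT mu.
pose split (v : 'rV[R]_n.+1) : measurableTypeR R * 'rV[R]_n :=
  (v ord0 ord0, \row_j v ord0 (lift ord0 j)).
have splitK p : split (rV_cons p) = p.
  case: p => a v; rewrite /split mxE unlift_none; congr pair.
  by apply/rowP => j; rewrite !mxE liftK.
have msplit : measurable_fun setT split.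
  apply/measurable_fun_pairP; split; first exact: measurable_rV_coord.
  apply: measurable_fun_rV => i.
  rewrite [X in measurable_fun _ X](_ : _ =
    (fun v : 'rV[R]_n.+1 => v ord0 (lift ord0 i))).
    exact: measurable_rV_coord.
  by apply/funext => v; rewrite /= mxE.
exists (fun k => split @^-1` (F k `*` G k)).
  rewrite -preimage_bigcup; apply/seteqP; split => // v _.
  have [k _ Fk] : (\bigcup_k F k) (split v).1 by rewrite -FT.
  have [l _ Gl] : (\bigcup_k G k) (split v).2 by rewrite -GT.
  exists (maxn k l) => //; split.
    by move: Fk; exact/subsetPset/ndF/leq_maxl.
  by move: Gl; exact/subsetPset/ndG/leq_maxr.
move=> k; have [mF Fk] := Foo k; have [mG Gk] := Goo k; split.
  by rewrite -[X in measurable X]setTI; apply: msplit => //; exact: measurableX.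
rewrite /lebesgue_rV_step /pushforward -comp_preimage.
rewrite (_ : split \o _ = id); last exact/funext.
by rewrite preimage_id product_measure1E// lte_mul_pinfty// ge0_fin_numE.
Qed.

HB.instance Definition _ := Measure_isSigmaFinite.Build _ _ _
  lebesgue_rV_step step_sigma_finite.

End rV_lebesgue_step.

(* Lebesgue measure on R^n: lambda^0 is the unit mass on the one-point space
   and lambda^{n+1} = lambda \x lambda^n. *)
Fixpoint lebesgue_rV (R : realType) (n : nat) :
    {sigma_finite_measure set 'rV[R]_n -> \bar R} :=
  match n with
  | 0 => \d_(0 : 'rV[R]_0)
  | m.+1 => lebesgue_rV_step (lebesgue_rV R m)
  end.

Section euclidean.
Context (R : realType) (n : nat).
Implicit Types (x y u p q : 'rV[R]_n) (K A : set 'rV[R]_n).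

Definition dot x y : R := \sum_(i < n) x ord0 i * y ord0 i.

(* The library norm `|x| on 'rV[R]_n is the sup norm; it induces the same
   topology. *)
Definition norm2 x : R := Num.sqrt (dot x x).

Definition vol A : \bar R := lebesgue_rV R n A.

Definition convex_body K := [/\ compact K, convex_set K & K° !=set0].

(* The supremum is a maximum when K is compact and nonempty. *)
Definition support K u : R := sup [set dot u x | x in K].

Definition width K u : R := support K u + support K (- u).

Definition centroid K : 'rV[R]_n :=
  (fine (vol K))^-1 *: \row_i \int[lebesgue_rV R n]_(x in K) (x ord0 i).

Definition polar_at K x : set 'rV[R]_n :=
  [set y | forall z, K z -> dot y (z - x) <= 1].

(* Extended-real valued: it is +oo when x is on the boundary of K. *)
Definition volume_product K x : \bar R := (vol K * vol (polar_at K x))%E.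

Definition min_volume_product K x :=
  K x /\ forall y, K y -> (volume_product K x <= volume_product K y)%E.

Definition santalo_point K s := unique (min_volume_product K) s.

Definition line p q : set 'rV[R]_n := [set p + t *: (q - p) | t in setT].

(* 1-dimensional volume of a subset A of the line p + R u, where u is a unit
   vector: the Lebesgue measure of A in the arc-length coordinate t. *)
Definition vol1 p u A : \bar R := lebesgue_measure [set t : R | A (p + t *: u)].

End euclidean.

(* Main.v *)
From HB Require Import structures.
From mathcomp Require Import all_boot all_order all_algebra.
From mathcomp Require Import all_classical all_reals all_analysis.
From mathcomp Require Import measurable_realfun ring lra.
Require Import Defs.

(** In dimension n = N + 1 the body is the truncated cone
      C = { (r, x) : 0 <= r <= 1, |x_i| <= 1 - k r },   k = 3 / (2 N + 1),
    over the cube.  The volume ratio (1 - k)^N of its two bases tends to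
    exp (-3/2), so neither base is negligible in high dimension and the height
    0 <= r <= 1 has a nondegenerate limit distribution on C.  The centroid
    and the Santaló point lie on the axis x = 0, at heights that solve different
    equations.

    Santaló point.  Let ||.||_1 be the support function of the cube.  For
    x = (t, y) with 0 < t < 1, a vector (s, z) lies in the polar body C^x iff s
    lies between two affine expressions in ||z||_1 and <y, z>
    ([polar_frustum]); integrating over s first gives
      vol(C^x) = 1 / (t (1 - t)) * int max(0, 1 + <y, z> - (1 - k t) ||z||_1) dz
    ([vol_polar_frustum]).  By convexity of the positive part, averaging over
    z and -z shows that y = 0 is the strict minimum for t fixed
    ([tentI_lt]), and the dilation z -> z / (1 - k t) shows that on the axis
      vol(C^(t, 0)) = const / (t (1 - t) (1 - k t)^N).
    The slope k is chosen to make t = 1/3 the critical point of the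
    denominator; it is the unique maximum by the inequality 1 + x <= exp x
    ([profile_lt]).  On the bases t = 0, 1 the polar body has infinite volume.
    Hence the Santaló point is (1/3, 0).

    Centroid.  By symmetry it lies on the axis; its height is
      int_0^1 r (1 - k r)^N dr / int_0^1 (1 - k r)^N dr,
    an explicit function of (1 - k)^(N + 1) <= exp(-3/2) which is at least
    1/3 + 1/300 for N >= 100 ([centroid_height_gap]); its limit is about 0.38.

    The line through the two points is the axis, which meets C in a segment of
    length 1, and C has width 1 in that direction. *)

Set Implicit Arguments.
Unset Strict Implicit.
Unset Printing Implicit Defensive.
Import Order.TTheory GRing.Theory Num.Theory.
Import numFieldNormedType.Exports.

Local Open Scope classical_set_scope.
Local Open Scope ring_scope.

(** * Lebesgue measure on row vectors: dilations, slices, boxes *)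

Section real_line.
Context (R : realType).
Local Open Scope ereal_scope.
Local Notation leb := (@lebesgue_measure R).

Lemma measurable_le_set (d : measure_display) (T : measurableType d)
    (f g : T -> R) : measurable_fun setT f -> measurable_fun setT g ->
  measurable [set v | (f v <= g v)%R].
Proof.
move=> mf mg; have := measurable_fun_ler mf mg => /(_ measurableT [set true] I).
by rewrite setTI.
Qed.

(** The left-hand side is a measure giving ]a, b] mass b - a, so the uniqueness
    of Lebesgue measure applies. *)
Lemma lebesgue_measure_dilate (c : R) (A : set R) : (0 < c)%R -> measurable A ->
  c%:E * pushforward leb (fun x : measurableTypeR R =>
    c * x : measurableTypeR R)%R A = leb A.
Proof.
move=> c0 mA.
have mf : measurable_fun setT (fun x : measurableTypeR R =>
  c * x : measurableTypeR R)%R.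
  exact: mulrl_measurable.
pose m : {measure set (measurableTypeR R) -> \bar R} :=
  measure_function_pushforward__canonical__measure_function_Measure leb mf.
pose c' := NngNum (ltW c0).
rewrite -[LHS]/(mscale c' m A);
  apply/esym/lebesgue_measure_unique => //= _ [[a b]] _ <-.
rewrite /mscale /= /pushforward.
rewrite [X in _ * leb X](_ : _ = `](a / c)%R, (b / c)%R]%classic); last first.
  apply/seteqP; split => x /=; rewrite !in_itv/= ltr_pdivrMr// ler_pdivlMr//
    mulrC//.
rewrite !lebesgue_measure_itv/= !lte_fin ltr_pM2r ?invr_gt0//.
case: ifP => _; last by rewrite mule0.
by rewrite -!EFinD -EFinM mulrBr !(mulrC c) !divfK ?gt_eqF.
Qed.

Lemma ge0_integral_dilate (c : R) (f : R -> \bar R) : (c != 0)%R ->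
  measurable_fun setT f -> (forall x, 0 <= f x) ->
  `|c|%:E * \int[leb]_x f (c * x)%R = \int[leb]_x f x.
Proof.
move=> c0 mf f0.
have pos (d : R) (h : R -> \bar R) : (0 < d)%R -> measurable_fun setT h ->
    (forall x, 0 <= h x) -> d%:E * \int[leb]_x h (d * x)%R = \int[leb]_x h x.
  move=> d0 mh h0.
  have mD : measurable_fun setT (fun x : measurableTypeR R =>
    d * x : measurableTypeR R)%R.
    exact: mulrl_measurable.
  pose m : {measure set (measurableTypeR R) -> \bar R} :=
    measure_function_pushforward__canonical__measure_function_Measure leb mD.
  pose d' := NngNum (ltW d0).
  rewrite -[X in _ * X](_ : \int[m]_x h x = _); last first.
    rewrite /m (ge0_integral_pushforward mD)//.
  rewrite -(ge0_integral_mscale _ _ d')//.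
  apply: eq_measure_integral => //= A mA _.
  by rewrite -[RHS](lebesgue_measure_dilate d0).
have neg (h : R -> \bar R) : measurable_fun setT h ->
    (forall x, 0 <= h x) -> \int[leb]_x h (- x)%R = \int[leb]_x h x.
  move=> mh h0; have mN : measurable_fun setT (fun x : measurableTypeR R =>
    (- x)%R : measurableTypeR R).
    exact: oppr_measurable.
  pose m : {measure set (measurableTypeR R) -> \bar R} :=
    measure_function_pushforward__canonical__measure_function_Measure leb mN.
  transitivity (\int[m]_x h x); last first.
    by apply: eq_measure_integral => A mA _ /=; exact: lebesgue_measureN.
  by rewrite /m (ge0_integral_pushforward mN).
have [cp|cn] := ltP 0%R c; first by rewrite gtr0_norm// pos.
have cn' : (c < 0)%R by rewrite lt_neqAle c0.
rewrite ltr0_norm// -[RHS](pos (- c)%R)// ?oppr_gt0//; congr (_ * _).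
rewrite -neg//; first by apply: eq_integral => x _; rewrite mulrN mulNr.
apply: measurableT_comp => //; exact: mulrl_measurable.
Qed.

Section tonelli.
Variable n : nat.
Variable f : 'rV[R]_n.+1 -> \bar R.
Hypothesis f0 : forall v, 0 <= f v.
Hypothesis mf : measurable_fun setT f.

Lemma lebesgue_rV_tonelli1 : \int[lebesgue_rV R n.+1]_v f v =
  \int[leb]_r \int[lebesgue_rV R n]_z f (rV_cons (r, z)).
Proof.
rewrite -[LHS]/(
  \int[pushforward (leb \x lebesgue_rV R n)%E (@rV_cons R n)]_v f v).
rewrite (ge0_integral_pushforward (@measurable_rV_cons R n))//=.
rewrite preimage_setT fubini_tonelli1//=.
apply: measurableT_comp => //; exact: measurable_rV_cons.
Qed.

Lemma lebesgue_rV_tonelli2 : \int[lebesgue_rV R n.+1]_v f v =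
  \int[lebesgue_rV R n]_z \int[leb]_r f (rV_cons (r, z)).
Proof.
rewrite -[LHS]/(
  \int[pushforward (leb \x lebesgue_rV R n)%E (@rV_cons R n)]_v f v).
rewrite (ge0_integral_pushforward (@measurable_rV_cons R n))//=.
rewrite preimage_setT fubini_tonelli2//=.
apply: measurableT_comp => //; exact: measurable_rV_cons.
Qed.
End tonelli.

End real_line.

Section slices.
Context (R : realType).
Local Open Scope ereal_scope.
Local Notation leb := (@lebesgue_measure R).

Lemma measurable_scale_rV n (c : R) :
  measurable_fun setT (fun z : 'rV[R]_n => (c *: z)%R).
Proof.
apply: measurable_fun_rV => i.
under eq_fun do rewrite mxE.
by apply: measurableT_comp; [exact: mulrl_measurable|
  exact: measurable_rV_coord].
Qed.

Lemma rV_consZ n (c r : R) (z : 'rV[R]_n) :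
  (c *: rV_cons (r, z) = rV_cons (c * r, c *: z))%R.
Proof.
by apply/rowP => i; rewrite !mxE/=; case: unliftP => [j _|_] //; rewrite mxE.
Qed.

Lemma measurable_rV_cons_head n (z : 'rV[R]_n) :
  measurable_fun setT (fun r : measurableTypeR R => rV_cons (r, z)).
Proof. by apply: measurableT_comp;
  [exact: measurable_rV_cons|exact: measurable_pair2]. Qed.

Lemma measurable_rV_cons_tail n (r : R) :
  measurable_fun setT (fun z : 'rV[R]_n => rV_cons (r : measurableTypeR R, z)).
Proof. by apply: measurableT_comp;
  [exact: measurable_rV_cons|exact: measurable_pair1]. Qed.

Lemma measurable_int_rV_cons n (f : 'rV[R]_n.+1 -> \bar R) :
  measurable_fun setT f -> (forall v, 0 <= f v) ->
  measurable_fun setT (fun z : 'rV[R]_n => \int[leb]_r f (rV_cons (r, z))).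
Proof.
move=> mf f0.
have mfp : measurable_fun setT (f \o @rV_cons R n).
  by apply: measurableT_comp => //; exact: measurable_rV_cons.
have := @measurable_fun_fubini_tonelli_G _ _ (measurableTypeR R) 'rV[R]_n R leb
  (f \o @rV_cons R n).
by move=> /(_ mfp); apply => p; exact: f0.
Qed.

(** Induction on the dimension: the slices of f (c *: _) are dilates of the
    slices of f.  Negative c is allowed, so that c = -1 gives the invariance
    under z |-> - z used in the symmetrization arguments. *)
Lemma ge0_integral_rV_dilate n (c : R) (f : 'rV[R]_n -> \bar R) : (c != 0)%R ->
  measurable_fun setT f -> (forall x, 0 <= f x) ->
  (`|c| ^+ n)%:E * \int[lebesgue_rV R n]_x f (c *: x)%R
    = \int[lebesgue_rV R n]_x f x.
Proof.
move=> c0; elim: n f => [|n IH] f mf f0.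
  rewrite expr0 mul1e; apply: eq_integral => x _.
  by congr f; apply/rowP; case.
have mfc : measurable_fun setT (fun v : 'rV[R]_n.+1 => f (c *: v)%R).
  by apply: measurableT_comp => //; exact: measurable_scale_rV.
rewrite !lebesgue_rV_tonelli2//.
pose G z := \int[leb]_r f (rV_cons (r, z)).
have mG : measurable_fun setT G.
  exact: measurable_int_rV_cons.
have G0 z : 0 <= G z by exact: integral_ge0.
rewrite -(IH _ mG G0) exprSr EFinM -muleA; congr (_ * _).
rewrite -ge0_integralZl//; last 2 first.
- exact: (@measurable_int_rV_cons _ (fun v => f (c *: v)%R)).
- by move=> z _; exact: integral_ge0.
apply: eq_integral => z _.
rewrite /G -[RHS](@ge0_integral_dilate _ c)//.
  by congr (_ * _); apply: eq_integral => r _; rewrite rV_consZ.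
by apply: measurableT_comp => //; exact: measurable_rV_cons_head.
Qed.

Lemma vol_indic n (S : set 'rV[R]_n) : measurable S ->
  vol S = \int[lebesgue_rV R n]_z (\1_S z)%:E.
Proof. by move=> mS; rewrite integral_indic// setIT. Qed.

Lemma vol_tonelli2 n (S : set 'rV[R]_n.+1) : measurable S ->
  vol S = \int[lebesgue_rV R n]_z leb [set r | S (rV_cons (r, z))].
Proof.
move=> mS; rewrite vol_indic//.
rewrite lebesgue_rV_tonelli2//; last first.
  exact/measurable_EFinP/measurable_indic.
apply: eq_integral => z _.
rewrite -[in RHS](setIT [set r | _]) -integral_indic//.
rewrite -[X in measurable X]setTI; exact: measurable_rV_cons_head.
Qed.

(** A closed ball of the sup norm, spelled out in coordinates so that it
    decomposes along [rV_cons] and is visibly measurable. *)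
Definition box n (p : 'rV[R]_n) (a : R) : set 'rV[R]_n :=
  [set z | forall i, `|z ord0 i - p ord0 i|%R <= a]%R.

Lemma measurable_box n (p : 'rV[R]_n) a : measurable (box p a).
Proof.
rewrite (_ : box p a = \bigcap_(i in [set: 'I_n])
   ((fun v : 'rV[R]_n => v ord0 i : measurableTypeR R) @^-1`
     `[(p ord0 i - a)%R, (p ord0 i + a)%R]%classic)).
  apply: fin_bigcap_measurable; first exact: finite_finset.
  move=> i _; rewrite -[X in measurable X]setTI.
  by apply: measurable_rV_coord.
apply/seteqP; split => z /= Hz i; have := Hz i; rewrite /= in_itv/= ler_distl//.
exact.
Qed.

Lemma vol_box n (p : 'rV[R]_n) a : (0 <= a)%R ->
  vol (box p a) = ((2 * a) ^+ n)%:E.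
Proof.
move=> a0; elim: n p => [|n IH] p.
  rewrite /vol /= diracE mem_set//=; by case.
rewrite vol_tonelli2; last exact: measurable_box.
pose p' : 'rV[R]_n := \row_j p ord0 (lift ord0 j).
have E (r : R) (z : 'rV[R]_n) : box p a (rV_cons (r, z)) <->
    (`|r - p ord0 ord0| <= a)%R /\ box p' a z.
  split=> [H|[H1 H2] i]; last first.
    by rewrite mxE; case: unliftP => [j ->|->]//=; have := H2 j; rewrite mxE.
  split; first by have := H ord0; rewrite mxE unlift_none.
  by move=> i; have := H (lift ord0 i); rewrite !mxE liftK.
transitivity (\int[lebesgue_rV R n]_z ((2 * a)%:E * (\1_(box p' a) z)%:E)).
  apply: eq_integral => z _; rewrite indicE.
  have [zb|zb] := pselect (box p' a z); last first.
    rewrite memNset// mule0 (_ : [set r | _] = set0) ?measure0//.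
    by apply/seteqP; split => // r /= /E[].
  rewrite mem_set// mule1 (_ : [set r | _]
    = `[(p ord0 ord0 - a)%R, (p ord0 ord0 + a)%R]%classic).
    rewrite lebesgue_measure_itv/= lte_fin; case: ifPn => [_|].
      by rewrite -EFinD; congr EFin; ring.
    rewrite -leNgt => H; have -> : a = 0%R by lra.
    by rewrite mulr0.
  by apply/seteqP; split => r /=; rewrite in_itv/= -ler_distl => H;
    [case/E: H|apply/E].
rewrite ge0_integralZl//; last 2 first.
- by apply/measurable_EFinP; apply: measurable_indic; exact: measurable_box.
- by rewrite lee_fin mulr_ge0.
rewrite integral_indic//; last exact: measurable_box.
rewrite setIT -[X in _ * X]/(vol (box p' a)) IH -EFinM -exprS//.
Qed.

End slices.

(** * Truncated cones over the cube and their polar bodies *)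

Section frustum_polar.
Context (R : realType) (N : nat).
Implicit Types (y z x : 'rV[R]_N) (c k t s r : R).

Definition norm1 z : R := \sum_i `|z ord0 i|.

Lemma dotC x y : dot x y = dot y x.
Proof. by apply: eq_bigr => i _; rewrite mulrC. Qed.

Lemma dotBr x y z : dot x (y - z) = dot x y - dot x z.
Proof. by rewrite -sumrB; apply: eq_bigr => i _; rewrite !mxE mulrBr. Qed.

Lemma dotNl y z : dot (- y) z = - dot y z.
Proof. by rewrite -sumrN; apply: eq_bigr => i _; rewrite !mxE mulNr. Qed.

Lemma dotNr y z : dot y (- z) = - dot y z.
Proof. by rewrite dotC dotNl dotC. Qed.

Lemma dot0l z : dot 0 z = 0.
Proof. by apply: big1 => i _; rewrite mxE mul0r. Qed.

Lemma norm1_ge0 z : 0 <= norm1 z.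
Proof. exact: sumr_ge0. Qed.

Lemma norm1N z : norm1 (- z) = norm1 z.
Proof. by apply: eq_bigr => i _; rewrite mxE normrN. Qed.

Lemma norm1Z c z : norm1 (c *: z) = `|c| * norm1 z.
Proof. by rewrite mulr_sumr; apply: eq_bigr => i _; rewrite mxE normrM. Qed.

Lemma box0P (a : R) x : box 0 a x <-> forall i, `|x ord0 i| <= a.
Proof. by split => H i; have := H i; rewrite mxE subr0. Qed.

(** With the next lemma: a * norm1 is the support function of [-a, a]^N. *)
Lemma dot_box (a : R) z x : box 0 a x -> dot z x <= a * norm1 z.
Proof.
move/box0P => H; rewrite mulr_sumr; apply: ler_sum => i _.
by rewrite (le_trans (ler_norm _))// normrM mulrC ler_wpM2r.
Qed.

Lemma dot_box_attained (a : R) z : 0 <= a ->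
  exists2 x, box 0 a x & dot z x = a * norm1 z.
Proof.
move=> a0; exists (\row_i (a * Num.sg (z ord0 i))).
  apply/box0P => i; rewrite mxE normrM ger0_norm// normr_sg.
  by case: (_ != 0); rewrite ?mulr1 ?mulr0.
by rewrite mulr_sumr; apply: eq_bigr => i _;
  rewrite mxE mulrCA [_ * Num.sg _]mulrC -normrEsg.
Qed.

Definition rV_tail (v : 'rV[R]_N.+1) : 'rV[R]_N := \row_j v ord0 (lift ord0 j).

Lemma rV_cons_head r z : rV_cons (r, z) ord0 ord0 = r.
Proof. by rewrite mxE unlift_none. Qed.

Lemma rV_cons_tail r z : rV_tail (rV_cons (r, z)) = z.
Proof. by apply/rowP => j; rewrite !mxE liftK. Qed.

Lemma rV_cons_eta (v : 'rV[R]_N.+1) : rV_cons (v ord0 ord0, rV_tail v) = v.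
Proof. by apply/rowP => i; rewrite !mxE; case: unliftP => [j|] ->//=;
  rewrite mxE. Qed.

Lemma rV_consB r1 r2 x y :
  rV_cons (r1, x) - rV_cons (r2, y) = rV_cons (r1 - r2, x - y) :> 'rV[R]_N.+1.
Proof. by apply/rowP => i; rewrite !mxE/=; case: unliftP => [j _|_] //=;
  rewrite !mxE. Qed.

Lemma dot_cons r1 r2 x y :
  dot (rV_cons (r1, x)) (rV_cons (r2, y)) = r1 * r2 + dot x y.
Proof.
rewrite /dot big_ord_recl !rV_cons_head; congr (_ + _); apply: eq_bigr => j _.
by rewrite !mxE !liftK.
Qed.

Definition frustum k : set 'rV[R]_N.+1 :=
  [set v : 'rV[R]_N.+1 | 0 <= v ord0 ord0 <= 1 /\
           box 0 (1 - k * v ord0 ord0) (rV_tail v)].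

Lemma frustumE k r x :
  frustum k (rV_cons (r, x)) <-> 0 <= r <= 1 /\ box 0 (1 - k * r) x.
Proof. by rewrite /frustum /= rV_cons_head rV_cons_tail. Qed.

(** The constraint imposed by the slice of C at height r is affine in r, so the
    two bases r = 0 and r = 1 impose all of them. *)
Lemma polar_frustum k t s y z : k <= 1 ->
  polar_at (frustum k) (rV_cons (t, y)) (rV_cons (s, z)) <->
  norm1 z <= 1 + t * s + dot y z /\
  (1 - k) * norm1 z <= 1 - (1 - t) * s + dot y z.
Proof.
move=> k1; split=> [H|[H0 H1] v].
  split.
    have [x xb xz] := dot_box_attained z (@ler01 R).
    have /H : frustum k (rV_cons (0, x)).
      by apply/frustumE; rewrite mulr0 subr0 lexx ler01.
    rewrite rV_consB dot_cons dotBr xz (dotC z y); lra.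
  have [x xb xz] : exists2 x, box 0 (1 - k) x & dot z x = (1 - k) * norm1 z.
    by apply: dot_box_attained; lra.
  have /H : frustum k (rV_cons (1, x)).
    by apply/frustumE; rewrite mulr1 lexx ler01.
  rewrite rV_consB dot_cons dotBr xz (dotC z y); lra.
rewrite -(rV_cons_eta v); move: (v ord0 ord0) (rV_tail v) => r x.
move=> /frustumE[/andP[r0 r1] /dot_box]/(_ z) xz.
rewrite rV_consB dot_cons dotBr (dotC z y).
have : (1 - r) * (norm1 z - (1 + t * s + dot y z)) <= 0
  by rewrite mulr_ge0_le0//; lra.
have : r * ((1 - k) * norm1 z - (1 - (1 - t) * s + dot y z)) <= 0
  by rewrite mulr_ge0_le0//; lra.
move: xz; move: (norm1 z) (dot z x) (dot y z) => *; nra.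
Qed.

Lemma measurable_norm1 : measurable_fun setT (norm1 : 'rV[R]_N -> R).
Proof.
apply: measurable_sum => i; apply: measurableT_comp; first
  exact: normr_measurable.
exact: measurable_rV_coord.
Qed.

Lemma measurable_dot y : measurable_fun setT (dot y : 'rV[R]_N -> R).
Proof.
apply: measurable_sum => i; apply: measurable_funM; first exact: measurable_cst.
exact: measurable_rV_coord.
Qed.

Lemma measurable_rV_tail : measurable_fun setT rV_tail.
Proof.
apply: measurable_fun_rV => i.
by under eq_fun do rewrite mxE; exact: measurable_rV_coord.
Qed.

Lemma measurable_polar_frustum k t y : k <= 1 ->
  measurable (polar_at (frustum k) (rV_cons (t, y))).
Proof.
move=> k1.
rewrite (_ : polar_at _ _ =
   [set v : 'rV[R]_N.+1 | norm1 (rV_tail v) <=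
     1 + t * v ord0 ord0 + dot y (rV_tail v)] `&`
   [set v : 'rV[R]_N.+1 | (1 - k) * norm1 (rV_tail v) <=
     1 - (1 - t) * v ord0 ord0 + dot y (rV_tail v)]); last first.
  apply/seteqP; split=> v.
    by rewrite -{1}(rV_cons_eta v) => /(polar_frustum _ _ _ _ k1).
  by move=> H; rewrite -(rV_cons_eta v); apply/(polar_frustum _ _ _ _ k1).
have ml : measurable_fun setT (norm1 \o rV_tail).
  by apply: measurableT_comp; [exact: measurable_norm1|
    exact: measurable_rV_tail].
have md : measurable_fun setT (dot y \o rV_tail).
  by apply: measurableT_comp; [exact: measurable_dot|exact: measurable_rV_tail].
apply: measurableI; apply: measurable_le_set.
- exact: ml.
- apply: measurable_funD => //; apply: measurable_funD => //.
  by apply: measurable_funM => //; exact: measurable_rV_coord.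
- exact: measurable_funM.
- apply: measurable_funD => //; apply: measurable_funB => //.
  by apply: measurable_funM => //; exact: measurable_rV_coord.
Qed.

(** For fixed z, the length of the section of the polar body in the direction
    of the axis is proportional to a tent; see [vol_polar_frustum]. *)
Definition tent y c z : R := Num.max 0 (1 + dot y z - c * norm1 z).

Lemma tent_ge0 y c z : 0 <= tent y c z.
Proof. by rewrite le_max lexx. Qed.

Lemma measurable_tent y c : measurable_fun setT (tent y c).
Proof.
apply: measurable_maxr => //; apply: measurable_funB.
  by apply: measurable_funD => //; exact: measurable_dot.
by apply: measurable_funM => //; exact: measurable_norm1.
Qed.

Local Open Scope ereal_scope.

Definition tentI y c : \bar R := \int[lebesgue_rV R N]_z (tent y c z)%:E.

Lemma measurable_polar_section k t y z : (k <= 1)%R ->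
  measurable [set s : R |
    polar_at (frustum k) (rV_cons (t, y)) (rV_cons (s, z))].
Proof.
move=> k1; have := @measurable_rV_cons_head R N z measurableT _
  (measurable_polar_frustum t y k1).
by rewrite setTI.
Qed.

Lemma vol_polar_frustum k t y : (k <= 1)%R -> (0 < t < 1)%R ->
  vol (polar_at (frustum k) (rV_cons (t, y)))
    = (t * (1 - t))^-1%:E * tentI y (1 - k * t).
Proof.
move=> k1 /andP[t0 t1].
rewrite vol_tonelli2; last exact: measurable_polar_frustum.
rewrite /tentI -ge0_integralZl//; last 3 first.
- by apply/measurable_EFinP; exact: measurable_tent.
- by move=> z _; rewrite lee_fin tent_ge0.
- by rewrite lee_fin invr_ge0 mulr_ge0//; lra.
apply: eq_integral => z _.
have t1' : (0 < 1 - t)%R by lra.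
rewrite (_ : [set s | _] = `[((norm1 z - 1 - dot y z) / t)%R,
    ((1 + dot y z - (1 - k) * norm1 z) / (1 - t))%R]%classic); last first.
  apply/seteqP; split=> s /=; rewrite in_itv/= ler_pdivrMr// ler_pdivlMr//.
    by move=> /polar_frustum[]// *; apply/andP; split; lra.
  by move=> /andP[H1 H2]; apply/polar_frustum => //; lra.
rewrite lebesgue_measure_itv/= lte_fin.
(* The length of the section, positive exactly where the tent is. *)
have E : ((1 + dot y z - (1 - k) * norm1 z) / (1 - t) -
          (norm1 z - 1 - dot y z) / t =
   (t * (1 - t))^-1 * (1 + dot y z - (1 - k * t) * norm1 z))%R.
  by field; rewrite !gt_eqF.
rewrite -subr_gt0 E pmulr_rgt0; last by rewrite invr_gt0 mulr_gt0.
rewrite /tent; case: ltP => H.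
  by rewrite -EFinB E -EFinM.
by rewrite mule0.
Qed.

End frustum_polar.

(** * Integrals of tents *)

Section tent_integral.
Context (R : realType) (N : nat).
Implicit Types (y z x : 'rV[R]_N) (c k t s r : R).
Local Notation mu := (lebesgue_rV R N).
Local Notation tentI := (@tentI R N).

Local Open Scope ereal_scope.

Lemma measurable_EFin_tent y c : measurable_fun setT (fun z => (tent y c z)%:E).
Proof. by apply/measurable_EFinP; exact: measurable_tent. Qed.

Lemma tentI_ge0 y c : 0 <= tentI y c.
Proof. by apply: integral_ge0 => z _; rewrite lee_fin tent_ge0. Qed.

(** [tent 0 c] is [tent 0 1] precomposed with the dilation by c. *)
Lemma tentI_dilate c : (0 < c)%R -> tentI 0 c = ((c ^+ N)^-1)%:E * tentI 0 1.
Proof.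
move=> c0; have cN : (c ^+ N)%:E * tentI 0 c = tentI 0 1.
  rewrite -[RHS](@ge0_integral_rV_dilate _ _ c)//; last 3 first.
  - by rewrite gt_eqF.
  - exact: measurable_EFin_tent.
  - by move=> z; rewrite lee_fin tent_ge0.
  rewrite gtr0_norm//; congr (_ * _).
  by apply: eq_integral => z _; rewrite /tent !dot0l norm1Z gtr0_norm// mul1r.
by rewrite -cN muleA -EFinM mulVf ?expf_neq0 ?gt_eqF// mul1e.
Qed.

Lemma norm1_coord z i : (`|z ord0 i| <= norm1 z)%R.
Proof. by rewrite /norm1 (bigD1 i)//= lerDl sumr_ge0. Qed.

Lemma norm1_box (a : R) z : box 0 a z -> (norm1 z <= N%:R * a)%R.
Proof.
move=> /box0P za.
have -> : (N%:R * a = \sum_(i < N) a)%R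
  by rewrite sumr_const card_ord mulr_natl.
exact: ler_sum.
Qed.

Lemma vol_box_gt0 (p : 'rV[R]_N) (a : R) : (0 < a)%R -> 0 < vol (box p a).
Proof. by move=> a0; rewrite vol_box ?ltW// lte_fin exprn_gt0// mulr_gt0. Qed.

Lemma tentI_fin : tentI 0 1 < +oo.
Proof.
apply: (@le_lt_trans _ _ (vol (box (0 : 'rV[R]_N) 1)));
  last by rewrite vol_box// ltry.
rewrite vol_indic; last exact: measurable_box.
apply: ge0_le_integral => //.
- by move=> z _; rewrite lee_fin tent_ge0.
- exact: measurable_EFin_tent.
- by apply/measurable_EFinP; apply: measurable_indic; exact: measurable_box.
move=> z _; rewrite lee_fin /tent dot0l addr0 mul1r ge_max; apply/andP;
  split => //.
have := norm1_ge0 z; have [zb l0|zb _] := pselect (box 0 1 z).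
  by rewrite indicE mem_set//= gerBl.
rewrite indicE memNset//= subr_le0.
have [i /negP] : exists i, ~ (`|z ord0 i| <= 1)%R.
  by apply/existsNP => H; apply: zb; apply/box0P.
by rewrite -ltNge => /ltW/le_trans; apply; exact: norm1_coord.
Qed.

Lemma tentI_gt0 : 0 < tentI 0 1.
Proof.
pose a : R := ((2 * N.+1%:R)^-1)%R.
have a0 : (0 < a)%R by rewrite invr_gt0 mulr_gt0.
apply: (@lt_le_trans _ _ ((2^-1)%:E * vol (box (0 : 'rV[R]_N) a))).
  by rewrite mule_gt0 ?vol_box_gt0// lte_fin invr_gt0.
rewrite vol_indic; last exact: measurable_box.
rewrite -ge0_integralZl//; last first.
  by apply/measurable_EFinP; apply: measurable_indic; exact: measurable_box.
apply: ge0_le_integral => //.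
- by apply: measurable_funeM; apply/measurable_EFinP; apply: measurable_indic;
  exact: measurable_box.
- exact: measurable_EFin_tent.
move=> z _; rewrite -EFinM lee_fin indicE.
have [zb|zb] := pselect (box 0 a z); last by rewrite memNset//= mulr0 tent_ge0.
rewrite mem_set//= mulr1 /tent le_max dot0l addr0 mul1r; apply/orP; right.
have := norm1_box zb.
have : (N%:R * a <= 2^-1)%R.
  by rewrite /a invfM mulrCA ger_pMr ?invr_gt0// ler_pdivrMr// mul1r ler_nat.
lra.
Qed.

Lemma tentIN y c : tentI (- y) c = tentI y c.
Proof.
rewrite /tentI -[RHS](ge0_integral_rV_dilate (c := -1))//; last 2 first.
- exact: measurable_EFin_tent.
- by move=> z; rewrite lee_fin tent_ge0.
rewrite normrN1 expr1n mul1e; apply: eq_integral => z _.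
by rewrite /tent scaleN1r dotNr dotNl norm1N.
Qed.

Lemma ler_dot_box y (p z : 'rV[R]_N) (rho : R) : box p rho z ->
  (dot y p - rho * norm1 y <= dot y z)%R.
Proof.
move=> zp; have : box 0 rho (p - z)%R.
  by apply/box0P => i; rewrite !mxE distrC; exact: zp.
by move=> H; have := dot_box y H; rewrite dotBr; lra.
Qed.

Lemma ler_norm1_box (p z : 'rV[R]_N) (rho : R) : box p rho z ->
  (`|norm1 z - norm1 p| <= N%:R * rho)%R.
Proof.
move=> zp; rewrite -sumrB.
apply: le_trans (ler_norm_sum _ _ _) _.
have -> : (N%:R * rho = \sum_(i < N) rho)%R
  by rewrite sumr_const card_ord mulr_natl.
by apply: ler_sum => i _; apply: le_trans (ler_dist_dist _ _) _.
Qed.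

(** By convexity of the positive part, the tents for y and - y have sum at least
    twice the tent for 0.  The inequality is strict near any point p
    where 1 - c * norm1 p < 0 < 1 + dot y p - c * norm1 p; such a point lies on
    the axis of a nonzero coordinate of y, at distance slightly more than 1 / c
    from the origin.  The uniform gap d on a whole box makes the inequality
    strict after integration. *)
Lemma tent_sum_gap y c : y != 0%R -> (0 < c)%R ->
  exists (p : 'rV[R]_N) (rho d : R), [/\ (0 < rho)%R, (0 < d)%R &
  forall z, (2 * tent 0 c z + d * \1_(box p rho) z <=
    tent y c z + tent (- y) c z)%R].
Proof.
move=> y0 c0.
have [i yi0] : exists i, y ord0 i != 0%R.
  apply/existsP; apply: contraNT y0 => /existsPn H.
  by apply/eqP/rowP => i; rewrite mxE; apply/eqP; rewrite -[_ == _]negbK H.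
set m := `|y ord0 i|%R; have m0 : (0 < m)%R by rewrite normr_gt0.
(* At p, 1 - c * norm1 p = - eta and 1 + dot y p - c * norm1 p >= eta. *)
pose eta := (m / (2 * c))%R.
have eta0 : (0 < eta)%R by rewrite divr_gt0// mulr_gt0.
pose a := ((1 + eta) / c)%R.
have a0 : (0 < a)%R by rewrite divr_gt0// addr_gt0.
have ca : (c * a = 1 + eta)%R by rewrite mulrC divfK// gt_eqF.
have am : (a * m - eta >= eta)%R.
  rewrite (_ : _ - _ = eta + m / c * eta)%R;
    last by rewrite /a /eta; field; rewrite gt_eqF.
  by rewrite lerDl mulr_ge0 ?ltW// divr_gt0.
pose p : 'rV[R]_N := \row_j (if j == i then a * Num.sg (y ord0 i) else 0)%R.
have lp : norm1 p = a.
  rewrite /norm1 (bigD1 i)//= big1 ?addr0;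
    last by move=> j /negbTE ji; rewrite mxE ji normr0.
  by rewrite mxE eqxx normrM normr_sg yi0 mulr1 gtr0_norm.
have yp : dot y p = (a * m)%R.
  rewrite /dot (bigD1 i)//= big1 ?addr0;
    last by move=> j /negbTE ji; rewrite mxE ji mulr0.
  by rewrite mxE eqxx mulrCA [(_ * Num.sg _)%R]mulrC -normrEsg.
(* The tent expressions vary by at most rho * B <= eta / 2 on the box. *)
pose B := (norm1 y + c * N%:R)%R.
have B0 : (0 <= B)%R by rewrite addr_ge0 ?norm1_ge0// mulr_ge0// ltW.
pose rho := (eta / (2 * (B + 1)))%R.
have rho0 : (0 < rho)%R by rewrite divr_gt0// mulr_gt0// ltr_wpDl.
have rB : (rho * B <= eta / 2)%R.
  rewrite /rho invfM mulrA -mulrA ger_pMr ?divr_gt0 ?mulr_gt0//.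
  by rewrite ler_pdivrMl ?mulr1 ?ltr_wpDl//; lra.
exists p, rho, (eta / 2)%R; split => //; first by rewrite divr_gt0.
move=> z; have A w : (0 <= tent w c z)%R /\ (1 + dot w z - c * norm1 z <=
  tent w c z)%R.
  by rewrite /tent !le_max !lexx orbT.
have [A1 A2] := A y; have [] := A (- y)%R; rewrite dotNl => A3 A4.
rewrite {1}/tent dot0l addr0 indicE.
have [zb|zb] := pselect (box p rho z); last first.
  rewrite memNset//= mulr0 addr0.
  by case: (ltP 0 (1 - c * norm1 z))%R => ?; lra.
rewrite mem_set//= mulr1.
have := ler_norm1_box zb; rewrite lp ler_distl => /andP[L1 L2].
have := ler_dot_box y zb; rewrite yp => L3.
have rBE : (rho * B = rho * norm1 y + c * (N%:R * rho))%R by rewrite /B; ring.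
have cL1 : (c * a - c * (N%:R * rho) <= c * norm1 z)%R
  by rewrite -mulrBr ler_wpM2l// ltW.
have cL2 : (c * norm1 z <= c * a + c * (N%:R * rho))%R
  by rewrite -mulrDr ler_wpM2l// ltW.
have cn : (0 <= c * (N%:R * rho))%R by apply: mulr_ge0;
  [exact: ltW|apply: mulr_ge0 => //; exact: ltW].
have yn : (0 <= rho * norm1 y)%R by rewrite mulr_ge0 ?norm1_ge0// ltW.
by case: (ltP 0 (1 - c * norm1 z))%R => ?; lra.
Qed.

(** The integral is even in y, so twice it is the integral of the sum of two
    tents, to which [tent_sum_gap] applies. *)
Lemma tentI_lt y c : y != 0%R -> (0 < c)%R -> tentI 0 c < tentI y c.
Proof.
move=> y0 c0; have [p [rho [d [rho0 d0 H]]]] := tent_sum_gap y0 c0.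
have fin0 : tentI 0 c \is a fin_num.
  rewrite ge0_fin_numE ?tentI_ge0// tentI_dilate// lte_mul_pinfty ?tentI_fin//.
  by rewrite lee_fin invr_ge0 exprn_ge0// ltW.
have : 2%:E * tentI 0 c + d%:E * vol (box p rho) <= tentI y c + tentI y c.
  rewrite -{2}(tentIN y) /tentI vol_indic; last exact: measurable_box.
  rewrite -!ge0_integralZl ?lee_fin ?(ltW d0)//; last 3 first.
  - by apply/measurable_EFinP; apply: measurable_indic; exact: measurable_box.
  - exact: measurable_EFin_tent.
  - by move=> z _; rewrite lee_fin tent_ge0.
  rewrite -!ge0_integralD//=; last 8 first.
  - by move=> z _; rewrite lee_fin tent_ge0.
  - exact: measurable_EFin_tent.
  - by move=> z _; rewrite lee_fin tent_ge0.
  - exact: measurable_EFin_tent.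
  - by move=> z _; rewrite -EFinM lee_fin mulr_ge0 ?tent_ge0.
  - by apply: measurable_funeM; exact: measurable_EFin_tent.
  - by move=> z _; rewrite -EFinM lee_fin mulr_ge0// ltW.
  - by apply: measurable_funeM; apply/measurable_EFinP;
    apply: measurable_indic; exact: measurable_box.
  apply: ge0_le_integral => //.
  - by move=> z _; rewrite -!EFinM -EFinD lee_fin addr_ge0// mulr_ge0
    ?tent_ge0// ltW.
  - apply/measurable_EFinP; apply: measurable_funD;
    apply: measurable_funM => //.
      exact: measurable_tent.
    by apply: measurable_indic; exact: measurable_box.
  - by apply/measurable_EFinP; apply: measurable_funD; exact: measurable_tent.
  - by move=> z _; rewrite -!EFinM -!EFinD lee_fin.
rewrite vol_box ?(ltW rho0)//;
  have := exprn_gt0 N (mulr_gt0 (@ltr0Sn R 1) rho0).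
move: ((2 * rho) ^+ N)%R => V V0.
case: (tentI y c) => [r| |]; rewrite -(fineK fin0) ?ltry//.
rewrite -!EFinM -!EFinD lee_fin lte_fin => L.
have := mulr_gt0 d0 V0; lra.
Qed.

End tent_integral.

(** * Integrals of the height profile of a truncated cone *)

Section height_profile.
Context (R : realType).

Lemma integral_deriv (p : {poly R}) (a b : R) : a < b ->
  (\int[lebesgue_measure]_(x in `[a, b]) (p^`().[x])%:E = (p.[b] - p.[a])%:E)%E.
Proof.
move=> ab.
have cp (q : {poly R}) : continuous (horner q).
  move=> x; apply/differentiable_continuous/derivable1_diffP.
  exact: derivable_horner.
rewrite EFinB; apply: (@continuous_FTC2 _ (horner p^`()) (horner p)) => //.
- by apply: continuous_subspaceT; exact: cp.
- split.
  + by move=> x _; exact: derivable_horner.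
  + by apply: cvg_at_right_filter; exact: cp.
  + by apply: cvg_at_left_filter; exact: cp.
- by move=> x _; rewrite -derivE.
Qed.

Variables (N : nat) (k : R).
Hypothesis k0 : 0 < k.

(** Closed forms of the integrals of (1 - k r)^N and r (1 - k r)^N over
    [0, 1]; see [integral_mass] and [integral_moment]. *)
Definition mass : R := (1 - (1 - k) ^+ N.+1) / (N.+1%:R * k).
Definition moment : R := (mass - (1 - k) ^+ N.+1) / (N.+2%:R * k).

Let w (r : R) : R := (1 - k * r) ^+ N.
Let pw m : {poly R} := (1 - k *: 'X) ^+ m.

Let pwE m r : (pw m).[r] = (1 - k * r) ^+ m.
Proof. by rewrite /pw !hornerE. Qed.

Let dpw m r : (pw m.+1)^`().[r] = - k * m.+1%:R * (1 - k * r) ^+ m.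
Proof.
rewrite deriv_exp !poly.derivE alg_polyC hornerMn -[_ *+ _]mulr_natr !hornerE/=.
by ring.
Qed.

Lemma integral_mass : (\int[lebesgue_measure]_(r in `[0%R, 1%R]) (w r)%:E
  = mass%:E)%E.
Proof.
have := integral_deriv (- (N.+1%:R * k)^-1 *: pw N.+1) (@ltr01 R).
rewrite !hornerZ !pwE mulr1 mulr0 subr0 expr1n => E.
transitivity ((- (N.+1%:R * k)^-1 * (1 - k) ^+ N.+1 - - (N.+1%:R * k)^-1 *
  1)%:E)%E.
  rewrite -E; apply: eq_integral => r _; congr EFin.
  rewrite derivZ hornerZ dpw /w; field;
    by rewrite gt_eqF//= addrC natr1 pnatr_eq0.
by congr EFin; rewrite /mass; ring.
Qed.

Lemma integral_moment : (\int[lebesgue_measure]_(r in `[0%R, 1%R]) (r * w r)%:E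
  = moment%:E)%E.
Proof.
(* An antiderivative: (r (1 - k r)^(N+1))' = (1 - (N+2) k r) (1 - k r)^N. *)
pose F : {poly R} := (N.+2%:R * k)^-1 *: (- (N.+1%:R * k)^-1 *: pw N.+1 - 'X *
  pw N.+1).
have := integral_deriv F (@ltr01 R) => E.
transitivity ((F.[1] - F.[0])%:E)%E.
  rewrite -E; apply: eq_integral => r _; congr EFin.
  have h1 : (1 : {poly R}).[r] = 1 by rewrite -polyC1 hornerC.
  rewrite /F !(derivZ, derivB, derivM, derivX, hornerZ, hornerD, hornerN,
    hornerM, hornerX, mul1r) !dpw !pwE h1 /w exprS -!natr1; field.
  by have := ler0n R N => ?; rewrite !gt_eqF//; lra.
by rewrite /F !(hornerZ, hornerD, hornerN, hornerM, hornerX) !pwE !(mulr1,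
  mulr0, mul0r, subr0, expr1n) /moment /mass; congr EFin; ring.
Qed.

End height_profile.

(** * Numerical estimates for the chosen slope *)

Section slope_estimates.
Context (R : realType) (N : nat).
Hypothesis N1 : (0 < N)%N.

(** The slope for which the derivative of log (t (1 - t) (1 - k t)^N) vanishes
    at t = 1/3. *)
Definition slope : R := 3 / (2 * N%:R + 1).

Lemma natr_ge1 : 1 <= N%:R :> R.
Proof. by rewrite ler1n. Qed.

Lemma slope_gt0 : 0 < slope.
Proof. by have N1' := natr_ge1; rewrite divr_gt0//; lra. Qed.

Lemma slope_le1 : slope <= 1.
Proof. have N1' := natr_ge1; rewrite ler_pdivrMr; lra. Qed.

(** With a = 3 t - 1, the quotient of the two sides is
      (1 + a / 2 - a^2 / 2) (1 - a / (2 N))^N,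
    where the power is at most exp (- a / 2) and 1 + a / 2 <= exp (a / 2), so
    that the term a^2 / 2 makes the bound strict for a != 0. *)
Lemma profile_lt (t : R) : 0 < t < 1 -> t != 3^-1 ->
  t * (1 - t) * (1 - slope * t) ^+ N
    < 3^-1 * (1 - 3^-1) * (1 - slope * 3^-1) ^+ N.
Proof.
move=> /andP[t0 t1] t3; have N1' := natr_ge1.
pose a := 3 * t - 1; have a0 : a != 0.
  by apply: contra_neq t3; rewrite /a => ?; lra.
have tE : t * (1 - t) = 2 / 9 * (1 + a / 2 - a ^+ 2 / 2) by rewrite /a; field.
have N2 : 2 * N%:R + 1 != 0 :> R by rewrite gt_eqF//; lra.
have N0 : N%:R != 0 :> R by rewrite gt_eqF//; lra.
set x0 := 1 - slope * 3^-1.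
have x00 : 0 < x0 by have := slope_le1; rewrite /x0; lra.
have xE : 1 - slope * t = x0 * (1 - a / (2 * N%:R)).
  by rewrite /x0 /slope /a; field; rewrite N0 N2.
have an : 0 <= 1 - a / (2 * N%:R).
  have : a / (2 * N%:R) <= 1 by rewrite ler_pdivrMr; rewrite /a; lra.
  lra.
rewrite xE exprMn tE.
have e1 : (1 - a / (2 * N%:R)) ^+ N <= expR (- (a / 2)).
  rewrite (_ : - (a / 2) = N%:R * - (a / (2 * N%:R))); last by field.
  rewrite expRM_natl; apply: lerXn2r; rewrite ?nnegrE ?expR_ge0//.
  exact: expR_ge1Dx.
have e2 := expR_ge1Dx (a / 2).
have a2 : 0 < a ^+ 2 by rewrite exprn_even_gt0.
have e3 : (1 + a / 2 - a ^+ 2 / 2) * (1 - a / (2 * N%:R)) ^+ N < 1.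
  apply: (@le_lt_trans _ _ ((1 + a / 2 - a ^+ 2 / 2) * expR (- (a / 2)))).
    apply: ler_wpM2l => //.
    have : 0 < t * (1 - t) by rewrite mulr_gt0//; lra.
    rewrite tE; lra.
  rewrite expRN ltr_pdivrMr ?expR_gt0// mul1r; lra.
have x0N : 0 < x0 ^+ N by rewrite exprn_gt0.
have -> : 3^-1 * (1 - 3^-1) * x0 ^+ N = 2 / 9 * x0 ^+ N by field.
rewrite [ltLHS](_ : _ = 2 / 9 * x0 ^+ N * ((1 + a / 2 - a ^+ 2 / 2) * (1 - a /
  (2 * N%:R)) ^+ N)); last by ring.
by rewrite gtr_pMr// mulr_gt0.
Qed.

(** exp (3/2) = exp (1/8)^12 >= (9/8)^12 = 4.109... *)
Lemma expR_three_halves : (41 / 10 : R) * expR (- (3 / 2)) <= 1.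
Proof.
have h : (8^-1 + 1) ^+ 12 <= expR (3 / 2 : R).
  rewrite (_ : 3 / 2 = 12%:R * 8^-1 :> R); last by field.
  rewrite expRM_natl; apply: lerXn2r; rewrite ?nnegrE ?expR_ge0//.
  by rewrite addrC; exact: expR_ge1Dx.
rewrite expRN ler_pdivrMr ?expR_gt0// mul1r; apply: le_trans h.
lra.
Qed.

Lemma slope_compl_pow_le : (1 - slope) ^+ N.+1 <= 10 / 41.
Proof.
have N1' := natr_ge1.
have h : (1 - slope) ^+ N.+1 <= expR (- (3 / 2)).
  apply: (@le_trans _ _ (expR (- (slope * N.+1%:R)))).
    rewrite (_ : - (slope * _) = N.+1%:R * - slope);
      last by rewrite mulrN mulrC.
    rewrite expRM_natl; apply: lerXn2r; rewrite ?nnegrE ?expR_ge0//.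
      by have := slope_le1; lra.
    exact: expR_ge1Dx.
  rewrite ler_expR lerN2 /slope -natr1 mulrAC ler_pdivlMr; lra.
have := expR_three_halves; lra.
Qed.

Lemma mass_gt0 : 0 < mass N slope.
Proof.
have := slope_compl_pow_le => q; apply: divr_gt0; first lra.
by rewrite mulr_gt0// slope_gt0.
Qed.

(** With p = (1 - k)^(N+1), the height of the centroid is
      (2 N + 1) / (3 (N + 2)) - (N + 1) / (N + 2) * p / (1 - p),
    which tends to 2/3 - p / (1 - p).  So what matters is that p stays below
    1/4, which p <= 10/41 ensures. *)
Lemma centroid_height_gap : (100 <= N)%N ->
  3^-1 + 300^-1 <= (mass N slope)^-1 * moment N slope.
Proof.
move=> N100; have Nge : 100 <= N%:R :> R by rewrite ler_nat.
have q := slope_compl_pow_le; rewrite mulrC ler_pdivlMr ?mass_gt0//.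
rewrite /moment ler_pdivlMr; last by rewrite mulr_gt0// slope_gt0.
have q0 : 0 <= (1 - slope) ^+ N.+1 by rewrite exprn_ge0//; have := slope_le1;
  lra.
rewrite /mass; move: ((1 - slope) ^+ N.+1) q q0 => p q q0.
have sn := slope_gt0.
have -> : (1 - p) / (N.+1%:R * slope)
  = (1 - p) * (2 * N%:R + 1) / (3 * (N%:R + 1)).
  by rewrite /slope -natr1; field; rewrite !gt_eqF//; lra.
have N10 : 0 < 3 * (N%:R + 1) :> R by lra.
rewrite -subr_ge0.
set e := (X in 0 <= X).
have -> : e = ((1 - p) * ((2 * N%:R + 1) - (N%:R + 2) * 3 * (3^-1 + 300^-1)) -
  p * (3 * (N%:R + 1))) / (3 * (N%:R + 1)).
  by rewrite /e /slope -!natr1; field; rewrite !gt_eqF//; lra.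
apply: divr_ge0; nra.
Qed.

End slope_estimates.

(** * The truncated cone as a convex body, and its centroid *)

Section frustum_body.
Context (R : realType) (N : nat) (k : R).
Hypotheses (k0 : 0 < k) (k1 : k <= 1).
Local Notation C := (@frustum R N k).

Lemma measurable_frustum : measurable C.
Proof.
have m0 : measurable_fun setT (fun v : 'rV[R]_N.+1 => v ord0 ord0 : R).
  exact: measurable_rV_coord.
rewrite (_ : C = [set v : 'rV[R]_N.+1 | (0 : R) <= v ord0 ord0] `&`
   ([set v : 'rV[R]_N.+1 | v ord0 ord0 <= 1] `&`
    \bigcap_(j in [set: 'I_N]) [set v : 'rV[R]_N.+1 |
       `|v ord0 (lift ord0 j)| <= 1 - k * v ord0 ord0])).
  apply: measurableI; [|apply: measurableI].
  - by apply: measurable_le_set => //; exact: measurable_cst.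
  - by apply: measurable_le_set => //; exact: measurable_cst.
  - apply: fin_bigcap_measurable => [|j _]; first exact: finite_finset.
    apply: measurable_le_set.
      apply: measurableT_comp; first exact: normr_measurable.
      exact: measurable_rV_coord.
    by apply: measurable_funB => //; apply: measurable_funM.
apply/seteqP; split=> v; rewrite /frustum /=.
  move=> [/andP[v0 v1] /box0P vb]; split => //; split => // j _.
  by have := vb j; rewrite mxE.
move=> [v0 [v1 vb]]; split; first by rewrite v0.
by apply/box0P => j; rewrite mxE; exact: vb.
Qed.

Lemma frustum_bound (v : 'rV[R]_N.+1) : C v -> forall i, -1 <= v ord0 i <= 1.
Proof.
move=> [/andP[v0 v1] /box0P vb] i; rewrite -ler_norml.
case: (unliftP ord0 i) => [j|] ->; last by rewrite ger0_norm.
have := vb j; rewrite mxE => /le_trans; apply.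
by rewrite gerBl mulr_ge0// ltW.
Qed.

Lemma compact_frustum : compact C.
Proof.
pose K := [set v : 'rV[R]_N.+1 | forall i, `[-1, 1]%classic (v ord0 i)].
have cK : compact K by apply: (@rV_compact R N.+1 (fun=> `[-1, 1]%classic)) =>
  i; exact: segment_compact.
apply: subclosed_compact cK _; last first.
  by move=> v /frustum_bound vb i; rewrite /= in_itv/=; exact: vb.
have c0 : continuous (fun v : 'rV[R]_N.+1 => v ord0 ord0 : R)
  by exact: coord_continuous.
have cpre (f : 'rV[R]_N.+1 -> R) (D : set R) : continuous f -> closed D ->
  closed (f @^-1` D).
  by move=> /continuous_closedP; exact.
rewrite (_ : C = ((fun v : 'rV[R]_N.+1 =>
  v ord0 ord0 : R) @^-1` [set x | 0 <= x]) `&`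
   (((fun v : 'rV[R]_N.+1 => v ord0 ord0 : R) @^-1` [set x | x <= 1]) `&`
    \bigcap_(j in [set: 'I_N]) ((fun v : 'rV[R]_N.+1 =>
       `|v ord0 (lift ord0 j)| + k * v ord0 ord0) @^-1` [set x | x <= 1]))).
  apply: closedI; [|apply: closedI].
  - by apply: cpre c0 _; exact: closed_ge.
  - by apply: cpre c0 _; exact: closed_le.
  - apply: closed_bigI => j _; apply: cpre; last exact: closed_le.
    have c1 : continuous (fun v : 'rV[R]_N.+1 => v ord0 (lift ord0 j) : R)
      by exact: coord_continuous.
    have n1 : continuous (fun v : 'rV[R]_N.+1 => `|v ord0 (lift ord0 j)| : R).
      by move=> v; exact: (continuous_comp (c1 v) (@norm_continuous _ R _)).
    have n2 : continuous (fun v : 'rV[R]_N.+1 => k * v ord0 ord0 : R).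
      by move=> v; exact: (continuous_comp (c0 v) (@mulrl_continuous R k _)).
    by move=> v; exact: (cvgD (n1 v) (n2 v)).
apply/seteqP; split=> v; rewrite /frustum /=.
  move=> [/andP[v0 v1] /box0P vb]; split => //; split => // j _.
  by have := vb j; rewrite mxE /= lerBrDr.
move=> [v0 [v1 vb]]; split; first by rewrite v0.
by apply/box0P => j; rewrite mxE lerBrDr; exact: vb.
Qed.

Lemma convex_frustum : convex_set C.
Proof.
apply/convex_setW => x y; rewrite !inE =>
  -[/andP[x0 x1] /box0P xb] [/andP[y0 y1] /box0P yb] t t0 t1.
rewrite inE /conv /= /unstable.onem; move: (t%:num) t0 t1 => {t}t t0 t1; split.
  rewrite !mxE; apply/andP; split; first by rewrite addr_ge0// mulr_ge0//; lra.
  have : t * (x ord0 ord0) <= t * 1 by rewrite ler_wpM2l// ltW.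
  have : (1 - t) * (y ord0 ord0) <= (1 - t) * 1 by rewrite ler_wpM2l//; lra.
  lra.
apply/box0P => j; have := xb j; have := yb j; rewrite !mxE => Hy Hx.
apply: le_trans (ler_normD _ _) _;
  rewrite !normrM (ger0_norm (ltW t0)) (@ger0_norm _ (1 - t)); last by lra.
have : t * `|x ord0 (lift ord0 j)| <= t * (1 - k * x ord0 ord0)
  by rewrite ler_wpM2l// ltW.
have : (1 - t) * `|y ord0 (lift ord0 j)| <= (1 - t) * (1 - k * y ord0 ord0)
  by rewrite ler_wpM2l//; lra.
lra.
Qed.

Lemma interior_frustum : k < 1 -> C° !=set0.
Proof.
move=> k1'; exists (rV_cons (2^-1, 0)).
pose e : R := (1 - k) / 2.
have e0 : 0 < e by rewrite divr_gt0// subr_gt0.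
apply/nbhs_ballP; exists e => //= v [_ vb].
have {}vb i : `|rV_cons (2^-1, 0 : 'rV[R]_N) ord0 i - v ord0 i| < e
  by exact: vb.
have [v0 v1] : 0 <= v ord0 ord0 /\ v ord0 ord0 <= 1.
  have : `|(2^-1 : R) - v ord0 ord0| < e by have := vb ord0;
    rewrite rV_cons_head.
  by rewrite ltr_distl => /andP[]; rewrite /e => ? ?; have := k0; split; lra.
split; first by rewrite v0.
apply/box0P => j; have := vb (lift ord0 j); rewrite !mxE liftK mxE sub0r normrN.
have : k * v ord0 ord0 <= k by rewrite ger_pMr.
rewrite /e; lra.
Qed.

Local Open Scope ereal_scope.

(** Slicing by the height: the slice of C at height r is a cube of side
    2 (1 - k r). *)
Lemma integral_frustum_height (g : R -> R) : (forall r, 0 <= r <= 1 ->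
  0 <= g r)%R ->
  measurable_fun setT g ->
  \int[lebesgue_rV R N.+1]_(v in C) (g (v ord0 ord0))%:E =
  \int[lebesgue_measure]_(r in `[0%R, 1%R]) (g r * (2 * (1 - k * r)) ^+ N)%:E.
Proof.
move=> g0 mg.
have mC := measurable_frustum.
rewrite integral_mkcond [RHS]integral_mkcond lebesgue_rV_tonelli1; last 2 first.
- move=> v; rewrite patchE; case: ifPn => // /set_mem[vr _]; rewrite lee_fin;
  exact: g0.
- apply/(measurable_restrictT _ mC).
  apply/measurable_EFinP; apply: measurable_funTS;
    apply: measurableT_comp => //.
  exact: measurable_rV_coord.
apply: eq_integral => r _; rewrite patchE.
case: ifPn => [/set_mem|/negP rn].
  rewrite /= in_itv/= => r01.
  transitivity (\int[lebesgue_rV R N]_z ((g r)%:E * (\1_(box 0 (1 - k * r))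
    z)%:E)).
    apply: eq_integral => z _; rewrite patchE indicE rV_cons_head.
    have [zb|zb] := pselect (box 0 (1 - k * r) z).
      by rewrite !mem_set ?mule1//; apply/frustumE.
    by rewrite !memNset ?mule0// => /frustumE[].
  rewrite ge0_integralZl//; last 2 first.
  - by apply/measurable_EFinP; apply: measurable_indic; exact: measurable_box.
  - by rewrite lee_fin g0.
  rewrite -vol_indic; last exact: measurable_box.
  rewrite vol_box ?EFinM//; move: r01 => /andP[r0 r1].
  by rewrite subr_ge0 (le_trans _ k1)// ger_pMr.
rewrite integral0_eq// => z _; rewrite patchE memNset// => /frustumE[r01 _].
by apply: rn; rewrite inE /= in_itv.
Qed.

Lemma vol_frustum : vol C = (2 ^+ N * mass N k)%:E.
Proof.
have mC := measurable_frustum.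
rewrite -[LHS]mul1e /vol -(integral_cst _ mC).
rewrite (@integral_frustum_height (cst 1%R))//.
rewrite EFinM -(integral_mass N k0) -ge0_integralZl//.
- by apply: eq_integral => r _; rewrite mul1r exprMn EFinM.
- apply/measurable_EFinP. apply: measurable_funTS. apply: measurable_funX.
  by apply: measurable_funB => //; exact: mulrl_measurable.
- move=> r; rewrite /= in_itv/= => /andP[r0 r1]; rewrite lee_fin exprn_ge0//.
  by rewrite subr_ge0 (le_trans _ k1)// ger_pMr.
Qed.

Lemma integral_frustum_moment :
  \int[lebesgue_rV R N.+1]_(v in C) (v ord0 ord0)%:E = (2 ^+ N * moment N k)%:E.
Proof.
rewrite (@integral_frustum_height id)//; last by move=> r /andP[].
rewrite EFinM -(integral_moment N k0) -ge0_integralZl//.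
- by apply: eq_integral => r _; rewrite exprMn mulrCA EFinM.
- apply/measurable_EFinP. apply: measurable_funTS. apply: measurable_funM => //.
  apply: measurable_funX.
  by apply: measurable_funB => //; exact: mulrl_measurable.
- move=> r; rewrite /= in_itv/= => /andP[r0 r1];
  rewrite lee_fin mulr_ge0// exprn_ge0//.
  by rewrite subr_ge0 (le_trans _ k1)// ger_pMr.
Qed.

(** The reflection (r, z) |-> (r, - z) preserves C and exchanges the positive
    and negative parts of a side coordinate. *)
Lemma integral_frustum_side (j : 'I_N) :
  (\int[lebesgue_rV R N.+1]_(v in C) (v ord0 (lift ord0 j)))%R = 0%R.
Proof.
have mC := measurable_frustum.
rewrite /Rintegral integralE integral_mkcond [X in _ - X]integral_mkcond.
set f := fun v : 'rV[R]_N.+1 => (v ord0 (lift ord0 j))%:E.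
have mf : measurable_fun setT f by apply/measurable_EFinP;
  exact: measurable_rV_coord.
have mp : measurable_fun setT (f^\+ \_ C).
  by apply/(measurable_restrictT _ mC); apply: measurable_funTS;
    exact: measurable_funepos.
have mn : measurable_fun setT (f^\- \_ C).
  by apply/(measurable_restrictT _ mC); apply: measurable_funTS;
    exact: measurable_funeneg.
have p0 v : 0 <= (f^\+ \_ C) v by rewrite patchE; case: ifP.
have n0 v : 0 <= (f^\- \_ C) v by rewrite patchE; case: ifP.
suff -> : \int[lebesgue_rV R N.+1]_v (f^\- \_ C) v
  = \int[lebesgue_rV R N.+1]_v (f^\+ \_ C) v.
  by case: (\int[_]_v _) => [r| |] //=; rewrite subrr.
rewrite !lebesgue_rV_tonelli1//; apply: eq_integral => r _.
rewrite -[RHS](@ge0_integral_rV_dilate _ _ (-1)%R)//; last first.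
  by apply: measurableT_comp => //; exact: measurable_rV_cons_tail.
rewrite normrN1 expr1n mul1e; apply: eq_integral => z _.
rewrite !patchE; have [zC|zC] := pselect (C (rV_cons (r, z))).
  rewrite !mem_set//; last first.
    move: zC => /frustumE[r01 /box0P zb]; apply/frustumE; split=> //.
    by apply/box0P => i; rewrite !mxE mulN1r normrN.
  by rewrite funeposE funenegE /f !mxE liftK !mxE mulN1r EFinN.
rewrite !memNset// => /frustumE[r01 /box0P zb]; apply: zC; apply/frustumE;
  split => //.
by apply/box0P => i; have := zb i; rewrite !mxE mulN1r normrN.
Qed.

Hypothesis mass0 : (0 < mass N k)%R.

Lemma centroid_frustum : centroid C = rV_cons ((mass N k)^-1 * moment N k, 0)%R.
Proof.
rewrite /centroid vol_frustum /=; apply/rowP => i; rewrite !mxE /=.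
case: unliftP => [j ->|->]; first by rewrite integral_frustum_side mulr0 mxE.
rewrite /Rintegral integral_frustum_moment /=.
by rewrite invfM mulrACA mulVf ?mul1r// expf_neq0.
Qed.

End frustum_body.

(** * The Santaló point of the truncated cone *)

(** For z in a small box the section of the polar body over z contains a
    half-line: downward for t = 0, upward for t = 1. *)
Lemma vol_polar_edge (R : realType) N (k t : R) (y : 'rV[R]_N) : 0 <= k ->
  k <= 1 ->
  t = 0 \/ t = 1 -> box 0 1 y ->
  vol (polar_at (frustum k) (rV_cons (t, y))) = +oo%E.
Proof.
move=> k0 k1 t01 yb.
have mS := measurable_polar_frustum t y k1.
rewrite vol_indic// lebesgue_rV_tonelli2//; last
  exact/measurable_EFinP/measurable_indic.
set S := polar_at _ _ in mS *.
pose a : R := (2 * N.+1%:R)^-1.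
have a0 : 0 < a by rewrite invr_gt0 mulr_gt0.
have mb := measurable_box (0 : 'rV[R]_N) a.
apply/eqP; rewrite eq_le leey /=.
apply: (@le_trans _ _ (\int[lebesgue_rV R N]_(z in box 0 a)
  (\int[lebesgue_measure]_r (\1_S (rV_cons (r, z)))%:E))%E); last first.
  apply: ge0_subset_integral => //.
  - apply: (@measurable_int_rV_cons _ _ (fun v => (\1_S v)%:E)) => //.
    exact/measurable_EFinP/measurable_indic.
  - by move=> z _; apply: integral_ge0.
rewrite (@eq_integral _ _ _ _ _ (cst +oo%E)).
  by rewrite integral_cst// gt0_mulye// (vol_box_gt0 0 a0).
move=> z /set_mem zb /=.
have mz : measurable [set r | S (rV_cons (r, z))]
  by exact: measurable_polar_section.
rewrite -[LHS]/(\int[lebesgue_measure]_r (\1_[set r | S (rV_cons (r, z))]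
  r)%:E)%E.
rewrite integral_indic// setIT.
have lz : norm1 z <= 2^-1.
  apply: le_trans (norm1_box zb) _.
  by rewrite /a invfM mulrCA ger_pMr ?invr_gt0// ler_pdivrMr// mul1r ler_nat.
have l0 := norm1_ge0 z.
have yz : - norm1 z <= dot y z.
  have : box 0 1 (- y) by apply/box0P => i; rewrite mxE normrN;
    exact: (box0P _ _).1 yb i.
  by move=> nb; have := dot_box z nb; rewrite dotNr mul1r dotC lerNl.
have kl : 0 <= k * norm1 z by rewrite mulr_ge0.
have big (D : set R) : measurable D -> D `<=` [set r | S (rV_cons (r, z))] ->
    lebesgue_measure D = +oo%E -> lebesgue_measure [set r | S (rV_cons (r, z))]
      = +oo%E.
  move=> mD DS Doo; apply/eqP; rewrite eq_le leey /= -Doo.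
  by apply: le_measure => //; rewrite inE.
case: t01 => t01.
  apply: (big `]-oo, 0%R]%classic) => //;
    last by rewrite lebesgue_measure_itv/= ?ltNyr ?ltry.
  move=> r /=; rewrite in_itv/= => r0; apply/polar_frustum => //; rewrite t01;
    split; lra.
apply: (big `[0%R, +oo[%classic) => //;
  last by rewrite lebesgue_measure_itv/= ?ltNyr ?ltry.
move=> r /=; rewrite in_itv/= andbT => r0; apply/polar_frustum => //;
  rewrite t01; split; lra.
Qed.

Lemma vol_polar_frustum_axis (R : realType) N (k t : R) : 0 <= k -> k <= 1 ->
  0 < t < 1 ->
  vol (polar_at (frustum k) (rV_cons (t, 0 : 'rV[R]_N))) =
  ((t * (1 - t) * (1 - k * t) ^+ N)^-1%:E * tentI (0 : 'rV[R]_N) 1)%E.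
Proof.
move=> k0 k1 /andP[t0 t1]; rewrite vol_polar_frustum// ?t0// tentI_dilate.
  by rewrite muleA -EFinM -invfM.
have : k * t <= 1 * t by rewrite ler_wpM2r// ltW.
lra.
Qed.

Section santalo.
Context (R : realType) (N : nat).
Local Notation k := (slope R N).
Local Notation C := (@frustum R N k).
Local Notation s := (rV_cons (3^-1 : R, 0 : 'rV[R]_N)).

(** A point is compared first with its projection to the axis, then along the
    axis with s; the bases are treated apart. *)
Lemma vol_polar_lt (x : 'rV[R]_N.+1) : (0 < N)%N -> C x -> x != s ->
  (vol (polar_at C s) < vol (polar_at C x))%E.
Proof.
move=> N1; have k0 : 0 < k := slope_gt0 R N1;
  have k1 : k <= 1 := slope_le1 R N1.
rewrite -(rV_cons_eta x); move: (x ord0 ord0) (rV_tail x) =>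
  t y /frustumE[/andP[t0 t1] yb] xs.
have s01 : 0 < (3^-1 : R) < 1 by apply/andP; split; lra.
rewrite vol_polar_frustum_axis//; last exact: ltW.
have I0 := tentI_gt0 R N; have Ioo := tentI_fin R N.
have [i i0 iE] : exists2 i : R, 0 < i & tentI (0 : 'rV[R]_N) 1 = i%:E.
  move: I0 Ioo; case: (tentI 0 1) => [i| |]//; rewrite lte_fin => i0 _.
  by exists i.
have kt : 0 <= k * t <= k by rewrite mulr_ge0 ?(ltW k0)//= ger_pMr.
have [te|te] := pselect (t = 0 \/ t = 1).
  rewrite vol_polar_edge//; last 2 first.
  - exact: ltW.
  - by apply/box0P => j; apply: le_trans ((box0P _ _).1 yb j) _; case/andP: kt;
    lra.
  by rewrite iE -EFinM ltry.
have {}t0 : 0 < t by rewrite lt_neqAle t0 andbT eq_sym; apply/eqP => t00;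
  apply: te; left.
have {}t1 : t < 1 by rewrite lt_neqAle t1 andbT; apply/eqP => t00; apply: te;
  right.
have t01 : 0 < t < 1 by rewrite t0.
have c0 : 0 < 1 - k * t.
  have : k * t <= 1 * t by rewrite ler_wpM2r// ltW.
  lra.
have p0 : 0 < t * (1 - t) by rewrite mulr_gt0// subr_gt0.
have offaxis : y != 0 ->
    (vol (polar_at C (rV_cons (t, 0%R : 'rV[R]_N)))
      < vol (polar_at C (rV_cons (t, y))))%E.
  move=> y0; rewrite !vol_polar_frustum// lte_pmul2l ?tentI_lt//.
  by rewrite lte_fin invr_gt0.
have pt : 0 < t * (1 - t) * (1 - k * t) ^+ N by rewrite mulr_gt0// exprn_gt0.
have onaxis : t != 3^-1 -> ((3^-1 * (1 - 3^-1) * (1 - k / 3) ^+ N)^-1%:E *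
  tentI (0 : 'rV[R]_N) 1 <
    vol (polar_at C (rV_cons (t, 0%R : 'rV[R]_N))))%E.
  move=> t3; rewrite vol_polar_frustum_axis//; last exact: ltW.
  rewrite iE -!EFinM lte_fin ltr_pM2r// ltf_pV2 ?posrE//; first
    exact: profile_lt.
  by apply: lt_trans (profile_lt N1 t01 t3).
have [y0|y0] := eqVneq y 0.
  rewrite y0; apply: onaxis; apply: contra_neq xs => ->; by rewrite y0.
apply: le_lt_trans (offaxis y0).
have [->|t3] := eqVneq t 3^-1; last exact/ltW/onaxis.
by rewrite vol_polar_frustum_axis// ltW.
Qed.

Lemma santalo_frustum : (0 < N)%N -> santalo_point C s.
Proof.
move=> N1; have k0 : 0 < k := slope_gt0 R N1;
  have k1 : k <= 1 := slope_le1 R N1.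
have m0 : 0 < 2 ^+ N * mass N k by rewrite mulr_gt0 ?exprn_gt0// mass_gt0.
have Cs : C s.
  apply/frustumE; split; first by apply/andP; split; lra.
  by apply/box0P => j; rewrite mxE normr0; lra.
have lt x : C x -> x != s -> (volume_product C s < volume_product C x)%E.
  move=> Cx xs; rewrite /volume_product vol_frustum//.
  by rewrite lte_pmul2l ?vol_polar_lt.
split.
  split; first exact: Cs.
  move=> x Cx; have [->|xs] := eqVneq x s; first exact: lexx.
  exact/ltW/lt.
move=> x [Cx xmin]; apply/eqP; rewrite eq_sym; apply/negPn/negP => xs.
by have := lt_le_trans (lt x Cx xs) (xmin s Cs); rewrite ltxx.
Qed.

End santalo.

(** * The direction from the Santaló point to the centroid *)

Lemma sup_max (R : realType) (A : set R) (a : R) : A a -> ubound A a ->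
  sup A = a.
Proof.
move=> Aa ubA; apply/le_anti/andP; split;
  first by apply: ge_sup => //; exists a.
by apply: ub_le_sup => //; exists a.
Qed.

Theorem theorem1 (R : realType) :
  exists (c : R) (n0 : nat), 0 < c /\
    forall n : nat, (n0 <= n)%N ->
      exists (C : set 'rV[R]_n) (s : 'rV[R]_n),
        [/\ convex_body C, santalo_point C s &
          let g := centroid C in
          let u := (norm2 (g - s))^-1 *: (g - s) in
          let len := fine (vol1 g u (line g s `&` C)) in
          [/\ g != s,
              c <= norm2 (g - s) / len &
              norm2 (g - s) / len = norm2 (g - s) / width C u]].
Proof.
exists 300^-1, 101%N; split; first by rewrite invr_gt0 ltr0n.
case=> [//|N] N100; rewrite ltnS in N100.
have N1 : (0 < N)%N by exact: leq_trans N100.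
pose k := slope R N; have k0 : 0 < k := slope_gt0 R N1;
  have k1 : k <= 1 := slope_le1 R N1.
have k1' : k < 1.
  have Nge : 100 <= N%:R :> R by rewrite ler_nat.
  by rewrite /k /slope ltr_pdivrMr; lra.
pose s : 'rV[R]_N.+1 := rV_cons (3^-1, 0).
exists (frustum k), s; split.
- by split; [exact: compact_frustum|exact: convex_frustum|
  exact: interior_frustum].
- exact: santalo_frustum.
have mass0 := mass_gt0 R N1.
rewrite /= centroid_frustum//.
set h := (_^-1 * _).
have hgap : 3^-1 + 300^-1 <= h := centroid_height_gap R N1 N100.
pose d := h - 3^-1.
have d0 : 300^-1 <= d by rewrite /d; lra.
have dpos : 0 < d by lra.
have gs : rV_cons (h, 0) - s = rV_cons (d, 0 : 'rV[R]_N).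
  by rewrite /s rV_consB subr0.
have nd : norm2 (rV_cons (d, 0 : 'rV[R]_N)) = d.
  by rewrite /norm2 dot_cons dot0l addr0 -expr2 sqrtr_sqr gtr0_norm.
pose e : 'rV[R]_N.+1 := rV_cons (1, 0).
have ue : d^-1 *: rV_cons (d, 0 : 'rV[R]_N) = e.
  by rewrite rV_consZ scaler0 mulVf// gt_eqF.
rewrite gs nd ue.
have dote v : dot e v = v ord0 ord0.
  by rewrite -(rV_cons_eta v) dot_cons dot0l addr0 mul1r !rV_cons_head.
have top : frustum k (rV_cons (1, 0 : 'rV[R]_N)).
  apply/frustumE; split; first by rewrite ler01 lexx.
  by apply/box0P => j; rewrite mxE normr0 mulr1 subr_ge0.
have bot : frustum k (rV_cons (0, 0 : 'rV[R]_N)).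
  apply/frustumE; split; first by rewrite ler01 lexx.
  by apply/box0P => j; rewrite mxE normr0 mulr0 subr0.
have wE : width (frustum k) e = 1.
  rewrite /width [support _ e](@sup_max _ _ 1); last 2 first.
  - by exists (rV_cons (1, 0)) => //; rewrite dote rV_cons_head.
  - by move=> _ [v [/andP[_ v1] _] <-]; rewrite dote.
  rewrite [support _ _](@sup_max _ _ 0) ?addr0//.
  - by exists (rV_cons (0, 0)) => //; rewrite dotNl dote rV_cons_head oppr0.
  - by move=> _ [v [/andP[v0 _] _] <-]; rewrite dotNl dote oppr_le0.
have lenE : vol1 (rV_cons (h, 0)) e (line (rV_cons (h, 0)) s `&` frustum k)
  = 1%E.
  rewrite /vol1 (_ : [set t | _] = `[- h, 1 - h]%classic); last first.
    have E t : rV_cons (h, 0) + t *: e = rV_cons (h + t, 0 : 'rV[R]_N).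
      rewrite /e rV_consZ scaler0 mulr1; apply/rowP => i; rewrite !mxE /=.
      by case: unliftP => [j _|_] //; rewrite !mxE addr0.
    apply/seteqP; split => t /=; rewrite in_itv/= E.
      by move=> [_ /frustumE[/andP[? ?] _]]; apply/andP; split; lra.
    move=> /andP[t1 t2]; split.
      exists (- (t / d)) => //.
      rewrite -E -[s - _]opprB gs scaleNr scalerN opprK; congr (_ + _).
      by rewrite /e !rV_consZ !scaler0 divfK ?gt_eqF// mulr1.
    apply/frustumE; split; first by apply/andP; split; lra.
    apply/box0P => j; rewrite mxE normr0 subr_ge0.
    have : k * (h + t) <= k * 1 by rewrite ler_wpM2l ?(ltW k0)//; lra.
    lra.
  rewrite lebesgue_measure_itv/= lte_fin ifT; last by lra.
  by rewrite -EFinB; congr EFin; ring.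
rewrite wE lenE /=; split => //.
  rewrite -subr_eq0 gs; apply/eqP => /rowP/(_ ord0); rewrite rV_cons_head mxE;
    lra.
by rewrite divr1.
Qed.
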